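(* As $n\to\infty$, $$\mathrm{ex}(Q_n, C_{10}) = \Omega\left(\frac{n}{\log^a n}\,2^n\right), \quad\text{where } a=\log_2 3.$$
   Context: The hypercube $Q_n$ is the graph with vertex set $\{A : A\subseteq [n]\}$ and edge set all pairs $\{A,B\}$ with $A\subseteq B$ and $|A|=|B|-1$. $C_{10}$ is the cycle of length $10$. For a graph $H$, $\mathrm{ex}(Q_n,H)$ is the largest number of edges in a subgraph $G$ of $Q_n$ such that no subgraph of $G$ is isomorphic to $H$. $\log^a n$ means $(\log n)^a$. *)

(* Defs.v *)
From mathcomp Require Import all_boot.

Set Implicit Arguments.
Unset Strict Implicit.
Unset Printing Implicit Defensive.

Record sgraph := SGraph {
  vertex :> finType;
  adj : rel vertex;
  adj_sym : symmetric adj;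
  adj_irrefl : irreflexive adj }.

Definition edges (G : sgraph) : {set {set G}} :=
  [set e : {set G} | [exists x : G, [exists y : G, adj x y && (e == [set x; y])]]].

(* A pair S : {set G} * {set {set G}} stands for a vertex set S.1 and an edge
   set S.2; subgraphs need be neither induced nor spanning. *)
Definition is_subgraph (G : sgraph) (S : {set G} * {set {set G}}) : bool :=
  (S.2 \subset edges G) && [forall e in S.2, e \subset S.1].

Definition subgraph_of (G : sgraph) (S' S : {set G} * {set {set G}}) : bool :=
  [&& is_subgraph S', S'.1 \subset S.1 & S'.2 \subset S.2].

Definition isomorphic_to (H G : sgraph) (S : {set G} * {set {set G}}) : bool :=
  [exists f : {ffun H -> G},
    [&& injectiveb f, f @: [set: H] == S.1 &
        [forall x : H, forall y : H, adj x y == ([set f x; f y] \in S.2)]]].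

Definition free_of (H G : sgraph) (S : {set G} * {set {set G}}) : bool :=
  ~~ [exists S' : {set G} * {set {set G}},
        subgraph_of S' S && isomorphic_to H S'].

Definition ex (G H : sgraph) : nat :=
  \max_(S : {set G} * {set {set G}} | is_subgraph S && free_of H S) #|S.2|.

Section Hypercube.
Variable n : nat.

(* |A| = |B| - 1 is written |A| + 1 = |B| because subtraction on nat is
   truncated at 0. *)
Definition cube_cover (A B : {set 'I_n}) : bool :=
  (A \subset B) && (#|A|.+1 == #|B|).

Definition cube_adj (A B : {set 'I_n}) : bool :=
  cube_cover A B || cube_cover B A.

Lemma cube_adj_sym : symmetric cube_adj.
Proof. by move=> A B; rewrite /cube_adj orbC. Qed.

Lemma cube_adj_irrefl : irreflexive cube_adj.
Proof. by move=> A; rewrite /cube_adj /cube_cover orbb -addn1 -{2}[#|A|]addn0 eqn_add2l andbF. Qed.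

Definition hypercube : sgraph := SGraph cube_adj_sym cube_adj_irrefl.
End Hypercube.

Section CycleGraph.
Variable k : nat.

(* The successor ordS is cyclic on 'I_k.  For k >= 3 this is the cycle of
   length k; the conjunct i != j only excludes the loop arising for k = 1. *)
Definition cycle_adj (i j : 'I_k) : bool :=
  (i != j) && ((j == ordS i) || (i == ordS j)).

Lemma cycle_adj_sym : symmetric cycle_adj.
Proof. by move=> i j; rewrite /cycle_adj eq_sym orbC. Qed.

Lemma cycle_adj_irrefl : irreflexive cycle_adj.
Proof. by move=> i; rewrite /cycle_adj eqxx. Qed.

Definition cycle_graph : sgraph := SGraph cycle_adj_sym cycle_adj_irrefl.
End CycleGraph.

(* Main.v *)
Require Import Defs.
From mathcomp Require Import all_classical all_reals all_analysis.
From mathcomp Require Import all_boot all_order all_algebra.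
From mathcomp Require Import zify ring.
Set Implicit Arguments. Unset Strict Implicit. Unset Printing Implicit Defensive.
Import Order.TTheory GRing.Theory Num.Theory.
Import numFieldNormedType.Exports.

(** The proof gives the stronger bound [n * 2 ^ n <= 64 * ex Q_n C_10]
([ex_hypercube_C10_ge]); the logarithmic factor is then simply discarded.

An edge of the cube is a pair (A, i) with i not in A, joining A to A + i.
Keep only edges with |A| of one fixed parity, so that every cycle stays
between two consecutive levels r and r + 1.  In each such layer, choose a vector
v_j in F_2^(r+1) for every j in [n], an extra vector u and a bit b, and keep
the edge (A, i) when
- the vectors v_j for j in A + i form a basis,
- the vectors v_j for j in A together with u form a basis, and
- the number of elements of A smaller than i has parity b.
For random choices each edge of the layer survives with probability at least
1/16 ([card_good_edges]), so some choice keeps a sixteenth of the layer; one of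
the two parities of r then retains at least n 2^n / 64 edges.

The kept edges contain no three pairs (S + e, d), (S + d, c), (S + c, e)
([good_edges_triangle_free]): modulo the span of S, which has codimension 2,
the vectors of e, d, c and u would be pairwise independent, whereas F_2^2 has
only three nonzero vectors.

A 10-cycle between two levels alternately adds and removes an element.  It
uses five directions, each added once and removed once, because two
consecutive levels of the cube on four elements are too small for it.  Place
the ten steps on a circle; each element used gives a chord from the step
adding it to the step removing it.  The two steps of one direction see the
same parity for the number of smaller elements, so every chord crosses an even
number of chords with smaller label.  Crossing counts are also even altogether
and, as vertices do not repeat, no chord is uncrossed.  With five chords this
leaves only the chord diagram of the cyclic word c a b d e c d e a b, in which
one of the factors d e c d e and a b c a b starts with an addition
([ten_cycle_repeat]).  The steps + d, - e, + c, - d, + e exhibit exactly the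
three edges excluded above ([no_ten_cycle]). *)

(** * Ten-cycles between two levels of the cube *)

(** A subset of five ordered directions is encoded by its bit sequence, in
increasing order; a step of direction [w] flips bit [w]. *)
Definition toggle (s : bitseq) (w : nat) := set_nth false s w (~~ nth false s w).

(** Parity of the number of elements of [s] smaller than [w].  It is the same
before and after a step of direction [w]. *)
Definition parity_below (s : bitseq) (w : nat) := odd (count id (take w s)).

(** A walk, most recent items first: its steps, each with the parity seen by
that step, and the subsets it visits. *)
Definition history := (seq (nat * bool) * seq bitseq)%type.

Definition extend (h : history) (w : nat) : history :=
  let s := head [::] h.2 in
  ((w, parity_below s w) :: h.1, toggle s w :: h.2).

(** Direction [w] may be taken at step [k] after [h]: even steps add an element
and odd steps remove one, steps of equal direction see equal parities, and no
subset is visited twice except that the tenth step returns to the start. *)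
Definition admissible (k : nat) (h : history) (w : nat) :=
  let s := head [::] h.2 in
  [&& nth false s w == odd k,
      all (fun x => (x.1 == w) ==> (x.2 == parity_below s w)) h.1 &
      if k == 9 then toggle s w == last [::] h.2 else toggle s w \notin h.2].

(** All walks of [k] admissible steps from [s0]. *)
Fixpoint histories (s0 : bitseq) (k : nat) : seq history :=
  if k is j.+1 then
    flatten [seq [seq extend h w | w <- iota 0 5 & admissible j h w]
            | h <- histories s0 j]
  else [:: ([::], [:: s0])].

Fixpoint all_bitseqs m : seq bitseq :=
  if m is j.+1 then [seq b :: s | b <- [:: true; false], s <- all_bitseqs j]
  else [:: [::]].

Lemma mem_all_bitseqs s : s \in all_bitseqs (size s).
Proof.
elim: s => [|b s IHs] //; apply/allpairsP.
by exists (b, s); split=> //; case: b.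
Qed.

(** Some five cyclically consecutive steps of the closed word [ws], the first
of them at an even position, read x y z x y. *)
Definition has_repeat (ws : seq nat) :=
  has (fun j => (nth 0 ws j.*2 == nth 0 ws ((j.*2 + 3) %% 10)) &&
                (nth 0 ws j.*2.+1 == nth 0 ws ((j.*2 + 4) %% 10))) (iota 0 5).

(** The classification of chord diagrams, by exhaustive search: only 80 closed
walks are admissible. *)
Lemma histories_has_repeat :
  all (fun s => all (fun h => has_repeat (rev (map fst h.1))) (histories s 10))
      (all_bitseqs 5).
Proof. by vm_compute. Qed.

Section Words.
Variables (st : nat -> bitseq) (w : nat -> nat).
Hypothesis size_st : size (st 0) = 5.
Hypothesis w_lt5 : forall k, w k < 5.
Hypothesis nth_st : forall k, nth false (st k) (w k) = odd k.
Hypothesis stS : forall k, st k.+1 = toggle (st k) (w k).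
Hypothesis parity_st : forall j k,
  w j = w k -> parity_below (st j) (w j) = parity_below (st k) (w k).
Hypothesis inj_st : forall j k, j < k -> k < 10 -> st j <> st k.
Hypothesis closed_st : st 10 = st 0.

Let hist k : history :=
  (rev (mkseq (fun j => (w j, parity_below (st j) (w j))) k), rev (mkseq st k.+1)).

Lemma hist_mem k : k <= 10 -> hist k \in histories (st 0) k.
Proof.
elim: k => [|k IHk] ltk; first by rewrite inE.
apply/flattenP; exists [seq extend (hist k) v | v <- iota 0 5 & admissible k (hist k) v].
  by apply/mapP; exists (hist k) => //; apply: IHk; exact: ltnW.
have headE : head [::] (hist k).2 = st k by rewrite /= /mkseq -addn1 iotaD map_cat rev_cat.
apply/mapP; exists (w k); last first.
  rewrite /extend headE -stS /hist; congr pair.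
    by rewrite /mkseq -{1}addn1 iotaD map_cat rev_cat.
  by rewrite /mkseq -{1}addn1 iotaD map_cat rev_cat.
rewrite mem_filter mem_iota /= add0n w_lt5 andbT /admissible headE nth_st eqxx /= -stS.
apply/andP; split.
  apply/allP=> x; rewrite mem_rev => /mapP[j _ ->] /=.
  by apply/implyP => /eqP/parity_st ->.
case: eqP => [->|k9]; first by rewrite closed_st.
rewrite mem_rev; apply/negP => /mapP[j]; rewrite mem_iota add0n => /andP[_ ltj] E.
by apply: (@inj_st j k.+1) => //; lia.
Qed.

(** An admissible closed word has a factor x y z x y. *)
Lemma word_repeat : exists2 j, j < 5 &
  w j.*2 = w ((j.*2 + 3) %% 10) /\ w j.*2.+1 = w ((j.*2 + 4) %% 10).
Proof.
have st0 : st 0 \in all_bitseqs 5 by rewrite -size_st mem_all_bitseqs.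
have /allP/(_ _ (hist_mem (leqnn 10)))/hasP[j] := allP histories_has_repeat _ st0.
rewrite mem_iota add0n => /andP[_ ltj] /andP[].
rewrite map_rev revK !(nth_map (0, false)) ?size_mkseq ?nth_mkseq ?ltn_mod //=; try lia.
by move=> /eqP e1 /eqP e2; exists j.
Qed.
End Words.

Section Cycles.
Variables (n : nat) (g : nat -> {set 'I_n}) (d : nat -> 'I_n) (p : bool).
Hypothesis mem_d : forall k, (d k \in g k) = odd k.
Hypothesis memS : forall k x, (x \in g k.+1) = (x \in g k) (+) (x == d k).
Hypothesis periodic : forall k, g (k + 10) = g k.
Hypothesis periodic_d : forall k, d (k %% 10) = d k.
Hypothesis g_inj : forall j k, j < k -> k < 10 -> g j <> g k.
Hypothesis parity_d : forall k, odd #|[set a in g k | a < d k]| = p.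

(* The directions of even steps: at most five, and all of those used, since an
element removed at some step has to be added back. *)
Let D := sort (fun i j : 'I_n => i <= j) (undup [seq d j.*2 | j <- iota 0 5]).

Lemma even_mem_D k : ~~ odd k -> d k \in D.
Proof.
move=> ok; rewrite mem_sort mem_undup -periodic_d; apply/mapP; exists (k %% 10)./2.
  by rewrite mem_iota; lia.
by congr d; lia.
Qed.

Lemma mem_D k : d k \in D.
Proof.
case ok: (odd k); last by rewrite even_mem_D ?ok.
apply/negP => /negP dD.
(* If never added again, [d k] would be missing ten steps later. *)
have notin m : d k \notin g (k + m.+1).
  elim: m => [|m IHm]; first by rewrite addn1 memS mem_d ok eqxx.
  rewrite addnS memS negb_add (negbTE IHm) eq_sym eqbF_neg.
  apply/eqP => dkm; case oddkm : (odd (k + m.+1)).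
    by move: IHm; rewrite dkm mem_d oddkm.
  by move/negP: dD; apply; rewrite dkm even_mem_D ?oddkm.
by have := notin 9; rewrite periodic mem_d ok.
Qed.

Lemma uniq_D : uniq D. Proof. by rewrite sort_uniq undup_uniq. Qed.
Lemma size_D : size D <= 5.
Proof. by rewrite size_sort (leq_trans (size_undup _)). Qed.

Lemma notin_D x k : x \notin D -> (x \in g k) = (x \in g 0).
Proof.
move=> xD; elim: k => [|k IHk] //; rewrite memS IHk.
by case: eqP => [xd | _]; rewrite ?addbF // xd mem_D in xD *.
Qed.

(* Padded with absent elements when fewer than five directions are used. *)
Let st k := mkseq (fun j => nth false [seq x \in g k | x <- D] j) 5.
Let w k := index (d k) D.

Lemma w_lt_size k : w k < size D. Proof. by rewrite index_mem mem_D. Qed.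

Lemma w_lt5 k : w k < 5. Proof. exact: leq_trans (w_lt_size k) size_D. Qed.

Lemma take_st k : take (w k) (st k) = [seq x \in g k | x : 'I_n <- D & x < d k].
Proof.
have ltw := w_lt_size k; have leD := size_D.
rewrite -[in RHS](cat_take_drop (w k) D) filter_cat.
have sD : sorted (fun i j : 'I_n => i <= j) D by apply: sort_sorted => i j; exact: leq_total.
have tr : transitive (fun i j : 'I_n => i <= j) by move=> y x z; exact: leq_trans.
have -> : [seq x : 'I_n <- take (w k) D | x < d k] = take (w k) D.
  apply/all_filterP/allP => x /(nthP x)[j]; rewrite size_take ltw => ltj <-.
  rewrite nth_take // ltn_neqAle; have dE : d k = nth x D (w k) by rewrite nth_index ?mem_D.
  rewrite dE; apply/andP; split.
    rewrite (inj_eq val_inj) nth_uniq ?uniq_D //; [lia | exact: ltn_trans ltw].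
  by apply: (sorted_leq_nth tr _ x sD) => //; rewrite ?inE; lia.
have -> : [seq x : 'I_n <- drop (w k) D | x < d k] = [::].
  apply/eqP; rewrite -size_eq0 size_filter -leqn0 leqNgt -has_count.
  apply/hasPn => x /(nthP x)[j]; rewrite size_drop nth_drop => ltj <-.
  rewrite -leqNgt; have dE : d k = nth x D (w k) by rewrite nth_index ?mem_D.
  by rewrite dE; apply: (sorted_leq_nth tr _ x sD); rewrite ?inE -?ltn_subRL ?leq_addr.
have ltw5 := w_lt5 k.
rewrite cats0 map_take; apply: (@eq_from_nth _ false).
  by rewrite !size_take size_mkseq size_map ltw ltw5.
move=> j; rewrite size_take size_mkseq ltw5 => ltj.
by rewrite !nth_take // nth_mkseq // (ltn_trans ltj).
Qed.

(** Restricting to [D] shifts the parity by an amount that depends on the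
direction only, because the walk is constant outside [D]. *)
Lemma parity_below_st k :
  parity_below (st k) (w k) = p (+) odd #|[set a in g 0 | (a < d k) && (a \notin D)]|.
Proof.
rewrite /parity_below take_st count_map count_filter -(parity_d k).
have -> : [set a in g 0 | (a < d k) && (a \notin D)] = [set a in g k | a < d k] :\: [set a in D].
  apply/setP=> x; rewrite !inE; case xD: (x \in D); rewrite /= ?andbF ?andbT //.
  by rewrite (notin_D k) ?xD.
rewrite -(cardsID [set a in D] [set a in g k | a < d k]) oddD -addbA addbb addbF; congr odd.
rewrite -size_filter -(card_uniqP (filter_uniq _ uniq_D)).
by apply: eq_card => x; rewrite !inE mem_filter.
Qed.

(** A 10-periodic walk without repeated vertices, alternately adding and
removing elements, in which all steps see the same parity of smaller elements,
has five consecutive steps + x, - y, + z, - x, + y. *)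
Lemma ten_cycle_repeat :
  exists2 k, ~~ odd k & d k = d (k + 3) /\ d k.+1 = d (k + 4).
Proof.
have leD := size_D.
have nthE k j : nth false (st k) j = nth false [seq x \in g k | x <- D] j.
  have [ltj | lej] := ltnP j 5; first by rewrite nth_mkseq.
  by rewrite !nth_default ?size_mkseq ?size_map // (leq_trans leD).
have [||||||| j ltj [e1 e2]] := @word_repeat st w.
- by rewrite size_mkseq.
- exact: w_lt5.
- by move=> k; rewrite nthE (nth_map (d k)) ?w_lt_size // nth_index ?mem_D.
- move=> k; apply: (@eq_from_nth _ false).
    by rewrite size_set_nth !size_mkseq; apply/esym/maxn_idPr/w_lt5.
  move=> j _; rewrite nth_set_nth /= !nthE.
  have [lej | ltj] := leqP (size D) j.
    rewrite !(@nth_default _ _ _ j) ?size_map //; case: (j =P w k) => // jw.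
    by rewrite jw leqNgt w_lt_size in lej.
  rewrite !(nth_map (d k)) ?w_lt_size // memS nth_index ?mem_D //.
  have -> : (nth (d k) D j == d k) = (j == w k).
    by rewrite -[X in _ == X](@nth_index _ (d k) _ D) ?mem_D // nth_uniq ?uniq_D ?w_lt_size.
  by case: eqP => [->|_]; rewrite ?addbF // nth_index ?mem_D ?addbT.
- move=> i k wik; rewrite !parity_below_st.
  by have -> : d i = d k by rewrite -(nth_index (d k) (mem_D i)) -/(w i) wik nth_index ?mem_D.
- move=> i k ltik ltk e; apply: (g_inj ltik ltk); apply/setP => x.
  have [xD | xD] := boolP (x \in D); last by rewrite !(notin_D _ xD).
  have := congr1 (fun s => nth false s (index x D)) e.
  by rewrite !nthE !(nth_map x) ?index_mem // nth_index.
- by rewrite /st -(periodic 0).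
have dw i k : w i = w (k %% 10) -> d i = d k.
  by move=> e; rewrite -(periodic_d k) -(nth_index (d i) (mem_D i)) -/(w i) e nth_index ?mem_D.
by exists j.*2; rewrite ?odd_double //; split; apply: dw.
Qed.

End Cycles.

(** * Independent families of vectors over F_2 *)

Section Lin.
Variables (I : finType) (N : nat).
Implicit Types (v : {ffun I -> 'rV['F_2]_N}) (B : {set I}).

(** The span of the vectors indexed by [B]. *)
Definition rspan v B : 'M['F_2]_N := (\sum_(i in B) <<v i>>)%MS.

(** The vectors indexed by [B] are linearly independent. *)
Definition indep v B := \rank (rspan v B) == #|B|.

Lemma rspanU1 v B i : i \notin B ->
  rspan v (i |: B) = (<<v i>> + rspan v B)%MS.
Proof. by move=> iB; rewrite /rspan big_setU1. Qed.

Lemma mxrank_rspanU1 v B i : i \notin B ->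
  \rank (rspan v (i |: B)) = (~~ (v i <= rspan v B)%MS + \rank (rspan v B))%N.
Proof.
move=> iB; rewrite rspanU1 //; have [vB | vB] := boolP (v i <= _)%MS.
  by apply/eqmx_rank/eqmxP/addsmx_idPr; rewrite genmxE.
have lt : (\rank (rspan v B) < \rank (<<v i>> + rspan v B)%MS)%N.
  by apply: rank_ltmx; rewrite ltmxE addsmxSr addsmx_sub genmxE (negbTE vB).
have := (mxrank_adds_leqif <<v i>>%MS (rspan v B)).1.
have := rank_leq_row (v i); rewrite mxrank_gen; lia.
Qed.

Lemma mxrank_rspan_le v B : (\rank (rspan v B) <= #|B|)%N.
Proof.
have [m] := ubnP #|B|; elim: m B => // m IHm B leBm.
have [->|[i iB]] := set_0Vmem B; first by rewrite /rspan big_set0 mxrank0.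
rewrite -(setD1K iB) mxrank_rspanU1 ?setD11 // cardsU1 setD11 /=.
by apply: leq_add (leq_b1 _) (IHm _ _); rewrite (cardsD1 i) iB in leBm.
Qed.

Lemma indepU1 v B i : i \notin B ->
  indep v (i |: B) = indep v B && ~~ (v i <= rspan v B)%MS.
Proof.
move=> iB; rewrite /indep mxrank_rspanU1 // cardsU1 iB.
have := mxrank_rspan_le v B; case: (v i <= _)%MS; lia.
Qed.

Lemma card_rowF2 : #|{: 'rV['F_2]_N}| = 2 ^ N.
Proof. by rewrite card_mx mul1n card_Fp. Qed.

Lemma card_row_submx_le (W : 'M['F_2]_N) :
  #|[set t : 'rV['F_2]_N | (t <= W)%MS]| <= 2 ^ \rank W.
Proof.
have -> : 2 ^ \rank W = #|{: 'rV['F_2]_(\rank W)}| by rewrite card_mx mul1n card_Fp.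
rewrite -cardsT; pose f (c : 'rV['F_2]_(\rank W)) := (c *m row_base W)%R.
apply: leq_trans (subset_leq_card _) (leq_imset_card f _).
apply/subsetP => t; rewrite inE -(eq_row_base W) => /submxP[c ->].
by apply/imsetP; exists c.
Qed.

(** The family [v] with the vector of index [i] replaced by [t]. *)
Definition upd v i t : {ffun I -> 'rV['F_2]_N} :=
  [ffun j => if j == i then t else v j].

(** Resampling one vector of a uniformly random family leaves it uniform. *)
Lemma sum_upd (F : {ffun I -> 'rV['F_2]_N} -> nat) i :
  \sum_v \sum_t F (upd v i t) = 2 ^ N * \sum_v F v.
Proof.
(* (v, t) |-> (v with t at i, v i) is an involution on pairs. *)
pose swap (x : {ffun I -> 'rV['F_2]_N} * 'rV['F_2]_N) := (upd x.1 i x.2, x.1 i).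
have swapK : involutive swap.
  move=> [v t]; rewrite /swap /= ffunE eqxx; congr pair.
  by apply/ffunP => j; rewrite !ffunE; case: eqP => [->|].
rewrite pair_big /= -[LHS]/(\sum_x F (swap x).1) (reindex_inj (inv_inj swapK)).
under eq_bigr do rewrite swapK.
rewrite -(pair_big xpredT xpredT (fun v _ => F v)) /= big_distrr /=.
by apply: eq_bigr => v _; rewrite sum_nat_const card_rowF2.
Qed.

Lemma rspan_upd v B i t : i \notin B -> rspan (upd v i t) B = rspan v B.
Proof.
move=> iB; apply: eq_bigr => j jB; rewrite ffunE.
by case: eqP => // ji; rewrite -ji jB in iB.
Qed.

(** Given an event [Q] not involving the vector of index [i], and that [B] is
independent, the conditional probability that [i |: B] is independent is at
least 1 - 2 ^ (#|B| - N). *)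
Lemma card_indepU1 (Q : pred {ffun I -> 'rV['F_2]_N}) B i :
    i \notin B -> (forall v t, Q (upd v i t) = Q v) ->
  2 ^ N * #|[set v | Q v && indep v B]| <=
    2 ^ N * #|[set v | Q v && indep v (i |: B)]| +
    2 ^ #|B| * #|[set v | Q v && indep v B]|.
Proof.
move=> iB Qi; set X := [set v | Q v && indep v B].
have -> : 2 ^ N * #|[set v | Q v && indep v (i |: B)]| =
          \sum_(v in X) #|~: [set t : 'rV['F_2]_N | (t <= rspan v B)%MS]|.
  rewrite -sum1dep_card big_mkcond -(sum_upd _ i) [RHS]big_mkcond /=.
  apply: eq_bigr => v _; rewrite inE -sum1_card [in RHS]big_mkcond -/(indep v B).
  transitivity (\sum_(t : 'rV['F_2]_N)
      (if Q v && indep v B && ~~ (t <= rspan v B)%MS then 1 else 0)).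
    apply: eq_bigr => t _.
    by rewrite Qi indepU1 // /indep rspan_upd // ffunE eqxx andbA.
  case: (Q v && indep v B); last by rewrite big1.
  by apply: eq_bigr => t _; rewrite !inE.
rewrite mulnC [2 ^ #|B| * _]mulnC -!sum_nat_const -big_split leq_sum //= => v.
rewrite inE => /andP[_ /eqP rB].
rewrite -card_rowF2 -(cardsC [set t : 'rV['F_2]_N | (t <= rspan v B)%MS]) addnC.
by rewrite leq_add2l -rB card_row_submx_le.
Qed.

(** A random family is independent on [B] with probability at least
1 - 2 ^ (#|B| - N). *)
Lemma card_indep_ge B :
  2 ^ N * #|{ffun I -> 'rV['F_2]_N}| <=
  2 ^ N * #|[set v | indep v B]| + 2 ^ #|B| * #|{ffun I -> 'rV['F_2]_N}|.
Proof.
have [m] := ubnP #|B|; elim: m B => // m IHm B leBm.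
have [->|[i iB]] := set_0Vmem B.
  have -> : [set v | indep v set0] = setT.
    by apply/setP => v; rewrite !inE /indep /rspan big_set0 mxrank0 cards0.
  by rewrite cardsT leq_addr.
have iB' : i \notin B :\ i by rewrite setD11.
have := card_indepU1 (Q := xpredT) iB' (fun _ _ => erefl); rewrite setD1K //=.
have := IHm (B :\ i); rewrite (cardsD1 i) iB in leBm => /(_ leBm).
rewrite (cardsD1 i B) iB add1n expnS -mulnA.
have := leq_mul (leqnn (2 ^ #|B :\ i|)) (max_card [set v | indep v (B :\ i)]).
move: (2 ^ #|_| * _) (2 ^ #|_| * #|{ffun _}|) (2 ^ N * _) => x y z.
move: (2 ^ N * _) (2 ^ N * _) => s t; lia.
Qed.

Lemma indep_upd v B i t : i \notin B -> indep (upd v i t) B = indep v B.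
Proof. by move=> iB; rewrite /indep rspan_upd. Qed.

(** If #|A| = N - 1 then [A] is independent with probability at least 1/2, and
each of [i] and [j] then extends it to a basis with conditional probability at
least 1/2. *)
Lemma card_indep2_ge (A : {set I}) i j : i != j -> i \notin A -> j \notin A -> #|A|.+1 = N ->
  #|{ffun I -> 'rV['F_2]_N}| <=
  8 * #|[set v | indep v (i |: A) && indep v (j |: A)]|.
Proof.
move=> ij iA jA cA.
have e2 : 2 ^ N = 2 * 2 ^ #|A| by rewrite -cA expnS.
have := card_indep_ge A.
have := card_indepU1 (Q := xpredT) jA (fun _ _ => erefl).
have Qi v t : indep (upd v i t) (j |: A) = indep v (j |: A).
  by rewrite indep_upd // !inE negb_or ij iA.
have := card_indepU1 (Q := (fun v => indep v (j |: A))) iA Qi.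
have -> : [set v | indep v (j |: A) && indep v A] = [set v | indep v (j |: A)].
  by apply/setP => v; rewrite !inE indepU1 // andbAC andbb.
have -> : [set v | indep v (j |: A) && indep v (i |: A)]
        = [set v | indep v (i |: A) && indep v (j |: A)].
  by apply/setP => v; rewrite !inE andbC.
rewrite e2 /=; have : 0 < 2 ^ #|A| by rewrite expn_gt0.
nia.
Qed.

(** Over F_2, two vectors outside [W] that are dependent modulo [W] agree
modulo [W]. *)
Lemma sub_adds_rowF2 (t x : 'rV['F_2]_N) (W : 'M['F_2]_N) :
  (t <= <<x>> + W)%MS -> ~~ (t <= W)%MS -> ((t - x)%R <= W)%MS.
Proof.
case/sub_addsmxP => -[a b] /= tE.
have : ((a *m <<x>>)%R <= x)%MS by rewrite -(genmxE x) submxMl.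
case/sub_rVP => k kE; rewrite {}kE in tE.
have : k = 0%R \/ k = 1%R by case: k {tE} => [[|[|k]] ltk] //; [left | right]; apply/val_inj.
case=> k01; rewrite {}tE k01 ?scale0r ?add0r ?scale1r; first by rewrite submxMl.
by rewrite addrAC subrr add0r submxMl.
Qed.

(** Four vectors cannot be pairwise independent modulo a subspace of
codimension 2 over F_2: relative to the basis e, d, both u and c would be
congruent to e + d. *)
Lemma indep_no_triangle v (S : {set I}) (e d c u : I) : #|S|.+2 = N ->
    uniq [:: e; d; c; u] -> all (mem (~: S)) [:: e; d; c; u] ->
    indep v (d |: (e |: S)) -> indep v (c |: (d |: S)) -> indep v (e |: (c |: S)) ->
    indep v (u |: (e |: S)) -> indep v (u |: (d |: S)) -> ~~ indep v (u |: (c |: S)).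
Proof.
move=> cS; rewrite /= !inE !negb_or !andbT.
case/and3P=> /and3P[ed ec eu] /andP[dc du] cu /and4P[eS dS cS' uS].
move=> ied idc ice iue iud.
have full t : (t <= <<v e>> + (<<v d>> + rspan v S))%MS.
  have edS : e \notin d |: S by rewrite !inE negb_or ed.
  rewrite -!rspanU1 //; apply: submx_full.
  by rewrite /row_full setUCA (eqP ied) setUCA !cardsU1 edS dS add1n add1n cS.
have key i : i != e -> i != d -> i \notin S -> indep v (i |: (e |: S)) ->
    indep v (i |: (d |: S)) -> ((v i - v e - v d)%R <= rspan v S)%MS.
  move=> ie id iS; rewrite !(@indepU1 _ _ i) ?inE ?negb_or ?ie ?id ?iS // !rspanU1 //.
  case/andP=> _ ni_e /andP[_ ni_d].
  apply: sub_adds_rowF2; first by apply: sub_adds_rowF2.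
  apply: contra ni_e => le; rewrite -(subrK (v e) (v i)) addrC.
  by rewrite addmx_sub_adds ?genmxE.
have ku : ((v u - v e - v d)%R <= rspan v S)%MS by apply: key; rewrite // eq_sym.
have kc : ((v c - v e - v d)%R <= rspan v S)%MS.
  by apply: key; rewrite // 1?eq_sym // setUCA.
rewrite indepU1 ?inE ?negb_or 1?eq_sym ?cu // negb_and negbK rspanU1 //.
apply/orP; right.
have -> : v u = (v c + ((v u - v e - v d) - (v c - v e - v d)))%R.
  by rewrite !opprB; apply/rowP=> k; rewrite !mxE; ring.
by rewrite addmx_sub_adds ?genmxE // addmx_sub // eqmx_opp.
Qed.
End Lin.

(** * Dense triangle-free families of cube edges *)

Section Layer.
Variable n : nat.
Implicit Types (A S : {set 'I_n}) (x : {set 'I_n} * 'I_n).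

(** No three edges (S + e, d), (S + d, c), (S + c, e), where the pair (A, i)
stands for the edge from A to A + i. *)
Definition triangle_free (P : {set {set 'I_n} * 'I_n}) := forall S (e d c : 'I_n),
  ~ [/\ (e |: S, d) \in P, (d |: S, c) \in P & (c |: S, e) \in P].

(** The edges between the levels [r] and [r.+1] of the cube. *)
Definition layer r := [set x : {set 'I_n} * 'I_n | (#|x.1| == r) && (x.2 \notin x.1)].

(** Parity of the number of elements of [A] smaller than [i]. *)
Definition rank_odd A (i : 'I_n) := odd #|[set a in A | a < i]|.

(** The edges kept in layer [r].  The index [None] carries the extra vector u,
and [Some j] the vector of the element [j]. *)
Definition good_edges r (w : {ffun option 'I_n -> 'rV['F_2]_(r.+1)} * bool) :=
  [set x : {set 'I_n} * 'I_n in layer r |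
     [&& indep w.1 (None |: Some @: x.1), indep w.1 (Some x.2 |: Some @: x.1)
       & rank_odd x.1 x.2 == w.2]].

Lemma card_good_edges r x : x \in layer r ->
  #|{: {ffun option 'I_n -> 'rV['F_2]_(r.+1)} * bool}| <= 16 * #|[set w | x \in @good_edges r w]|.
Proof.
rewrite inE => /andP[/eqP cA xA].
set X := [set v | indep v (None |: Some @: x.1) && indep v (Some x.2 |: Some @: x.1)]
   : {set {ffun option 'I_n -> 'rV['F_2]_(r.+1)}}.
have -> : [set w | x \in @good_edges r w] = setX X [set rank_odd x.1 x.2].
  by apply/setP => -[v b]; rewrite !inE /= cA eqxx xA -!andbA [b == _]eq_sym.
rewrite cardsX cards1 muln1 card_prod card_bool.
have SA : Some x.2 \notin Some @: x.1 by rewrite mem_imset //; exact: Some_inj.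
have NA : None \notin Some @: x.1 by apply/imsetP => -[].
have cSA : #|Some @: x.1|.+1 = r.+1 by rewrite card_imset ?cA //; exact: Some_inj.
rewrite mulnC (_ : 16 = 2 * 8) // -mulnA leq_mul2l /=.
exact: (card_indep2_ge (isT : None != Some x.2) NA SA cSA).
Qed.

Lemma good_edges_triangle_free r w : triangle_free (@good_edges r w).
Proof.
move=> S e d c; rewrite !inE /=.
case=> /andP[/andP[/eqP ce dS] /and3P[ue de _]] /andP[/andP[/eqP cd cS] /and3P[ud cd' _]].
case/andP=> [/andP[/eqP cc eS] /and3P[uc ec _]].
move: dS cS eS; rewrite !negb_or => /andP[d_e dS] /andP[c_d cS] /andP[e_c eS].
move: de cd' ec; rewrite -?imsetU1 => de cd' ec.
have := @indep_no_triangle _ _ w.1 (Some @: S) (Some e) (Some d) (Some c) None.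
rewrite -!imsetU1 => /(_ _ _ _ de cd' ec ue ud); rewrite uc card_imset; last exact: Some_inj.
move=> absurd; suff: ~~ true by []; apply: absurd.
- by rewrite -ce cardsU1 eS.
- rewrite /= !inE /= !negb_or !andbT !(inj_eq (@Some_inj _)).
  by rewrite (eq_sym e d) d_e e_c eq_sym c_d.
- rewrite /= !inE !mem_imset; [|exact: Some_inj..].
  by rewrite eS dS cS /= andbT; apply/imsetP => -[].
Qed.

(** By averaging, some choice keeps a sixteenth of the layer. *)
Lemma ex_good_layer r : exists (P : {set {set 'I_n} * 'I_n}) b,
  [/\ P \subset layer r, {in P, forall x, rank_odd x.1 x.2 = b}, triangle_free P
    & #|layer r| <= 16 * #|P|].
Proof.
pose Om := ({ffun option 'I_n -> 'rV['F_2]_(r.+1)} * bool)%type.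
have w0 : Om by exact: ([ffun=> 0%R], true).
have [w _ w_max] := @arg_maxnP Om w0 xpredT (fun w => #|good_edges w|) isT.
have large : #|layer r| <= 16 * #|good_edges w|.
  have Om_gt0 : 0 < #|{: Om}| by apply/card_gt0P; exists w0.
  rewrite -(leq_pmul2l Om_gt0) mulnCA.
  apply: (@leq_trans (16 * \sum_(w' : Om) #|good_edges w'|)); last first.
    by rewrite leq_mul2l -sum_nat_const leq_sum // => w' _; apply: w_max.
  have -> : \sum_(w : Om) #|good_edges w| =
      \sum_(x in layer r) #|[set w : Om | x \in good_edges w]|.
    under [LHS]eq_bigr => w' _ do rewrite -sum1_card.
    under [RHS]eq_bigr => x _ do rewrite -sum1_card.
    rewrite (exchange_big_dep (mem (layer r))) /=; last by move=> w' x _; rewrite inE => /andP[].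
    by apply: eq_bigr => x _; apply: eq_bigl => w'; rewrite !inE.
  rewrite mulnC -sum_nat_const big_distrr /= leq_sum // => x; exact: card_good_edges.
exists (good_edges w), w.2; split=> //; last exact: good_edges_triangle_free.
  by apply/subsetP => x; rewrite inE => /andP[].
by move=> x; rewrite inE => /and4P[_ _ _ /eqP].
Qed.

(** Complementing [A] exchanges the pairs with [i] outside [A] and inside [A]. *)
Lemma card_cube_edges :
  2 * #|[set x : {set 'I_n} * 'I_n | x.2 \notin x.1]| = n * 2 ^ n.
Proof.
set X := [set x | _]; pose f x := (~: x.1, x.2).
have fK : involutive f by move=> [A i]; rewrite /f /= setCK.
have fX : #|~: X| = #|X|.
  rewrite -(card_imset (mem X) (inv_inj fK)); apply: eq_card => x.
  by rewrite -[x in RHS]fK mem_imset ?inE ?negbK //; apply: inv_inj.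
have := cardsC X; rewrite fX addnn -mul2n => ->.
by rewrite card_prod card_ord -cardsT -powersetT card_powerset cardsT card_ord mulnC.
Qed.

(** The union of the good layers whose lower level has parity [q], for the
better of the two values of [q]. *)
Lemma ex_dense_family : exists (P : {set {set 'I_n} * 'I_n}) q,
  [/\ {in P, forall x : {set 'I_n} * 'I_n, x.2 \notin x.1 /\ odd #|x.1| = q},
      {in P &, forall x y : {set 'I_n} * 'I_n, #|x.1| = #|y.1| ->
        rank_odd x.1 x.2 = rank_odd y.1 y.2},
      triangle_free P & n * 2 ^ n <= 64 * #|P|].
Proof.
have /fin_all_exists[P0 HP] (r : 'I_n.+1) := ex_good_layer r.
have /fin_all_exists[b0 {}HP] := HP.
have ltn1 (A : {set 'I_n}) : #|A| < n.+1.
  by rewrite ltnS; apply: leq_trans (max_card _) _; rewrite card_ord.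
pose idx (A : {set 'I_n}) := Ordinal (ltn1 A).
pose Q q := [set x : {set 'I_n} * 'I_n | (x \in P0 (idx x.1)) && (odd #|x.1| == q)].
have Q_layer x r : x \in P0 r -> [/\ #|x.1| = r, x.2 \notin x.1 & idx x.1 = r].
  have [/subsetP sub _ _ _] := HP r => /sub; rewrite inE => /andP[/eqP e xx].
  by split=> //; apply/val_inj.
have QP q : triangle_free (Q q).
  move=> S e d c; rewrite !inE /= => -[/andP[Pd _] /andP[Pc _] /andP[Pe _]].
  have [_ _ tf _] := HP (idx (e |: S)); apply: (tf S e d c).
  have [_ dn _] := Q_layer _ _ Pd; have [_ cn _] := Q_layer _ _ Pc.
  have [_ en _] := Q_layer _ _ Pe.
  move: dn cn en; rewrite !inE !negb_or => /andP[_ dS] /andP[_ cS] /andP[_ eS].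
  have ed : idx (d |: S) = idx (e |: S) by apply/val_inj; rewrite /= !cardsU1 eS dS.
  have ec : idx (c |: S) = idx (e |: S) by apply/val_inj; rewrite /= !cardsU1 eS cS.
  by rewrite ed in Pc; rewrite ec in Pe.
have large : n * 2 ^ n <= 64 * #|Q false| \/ n * 2 ^ n <= 64 * #|Q true|.
  have : #|[set x : {set 'I_n} * 'I_n | x.2 \notin x.1]| <= 16 * (#|Q false| + #|Q true|).
    have -> : #|Q false| + #|Q true| = #|[set x : {set 'I_n} * 'I_n | x \in P0 (idx x.1)]|.
      rewrite addnC -(cardsID [set x : {set 'I_n} * 'I_n | odd #|x.1|] [set x | x \in _]).
      congr (_ + _).
        by apply: eq_card => x; rewrite !inE eqb_id.
      by apply: eq_card => x; rewrite !inE eqbF_neg andbC.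
    rewrite -!sum1_card (partition_big (fun x => idx x.1) xpredT) //=.
    rewrite [in leqRHS](partition_big (fun x => idx x.1) xpredT) //= big_distrr /=.
    apply: leq_sum => r _; have [_ _ _] := HP r; congr (_ <= 16 * _).
      by rewrite -sum1_card; apply: eq_bigl => x; rewrite !inE andbC.
    rewrite -sum1_card; apply: eq_bigl => x; rewrite !inE.
    apply/idP/andP => [Px | [Px /eqP <-] //].
    by have [_ _ e] := Q_layer _ _ Px; rewrite e Px eqxx.
  have := card_cube_edges; lia.
have [q lq] : exists q, n * 2 ^ n <= 64 * #|Q q|.
  by case: large => le; [exists false | exists true].
exists (Q q), q; split=> //.
  by move=> x; rewrite inE => /andP[/Q_layer[_ ? _] /eqP].
move=> x y; rewrite !inE => /andP[Px _] /andP[Py _] cxy.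
have exy : idx x.1 = idx y.1 by apply/val_inj.
have [_ rk _ _] := HP (idx y.1).
by rewrite exy in Px; rewrite !rk.
Qed.
End Layer.

(** * Absence of ten-cycles *)

Section CycleFree.
Variables (n : nat) (P : {set {set 'I_n} * 'I_n}) (q : bool).
Hypothesis P_up : {in P, forall x : {set 'I_n} * 'I_n, x.2 \notin x.1 /\ odd #|x.1| = q}.
Hypothesis P_rank :
  {in P &, forall x y : {set 'I_n} * 'I_n, #|x.1| = #|y.1| ->
        rank_odd x.1 x.2 = rank_odd y.1 y.2}.
Hypothesis P_triangle : triangle_free P.

(** The kept edges contain no closed walk through ten distinct vertices. *)
Lemma no_ten_cycle (f : 'I_10 -> {set 'I_n}) : injective f ->
  (forall i, exists2 x, x \in P & [set f i; f (ordS i)] = [set x.1; x.2 |: x.1]) -> False.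
Proof.
move=> f_inj f_edge.
(* [up A B]: the kept edge from [A] to [B], with [A] on the lower level. *)
pose up A B := exists2 x, x \in P & A = x.1 /\ B = x.2 |: x.1.
have f_up i : up (f i) (f (ordS i)) \/ up (f (ordS i)) (f i).
  have [x xP E] := f_edge i; have [xx _] := P_up xP.
  have fi : f i \in [set x.1; x.2 |: x.1] by rewrite -E set21.
  have fi' : f (ordS i) \in [set x.1; x.2 |: x.1] by rewrite -E set22.
  have E1 : x.1 \in [set f i; f (ordS i)] by rewrite E set21.
  have E2 : x.2 |: x.1 \in [set f i; f (ordS i)] by rewrite E set22.
  case/set2P: fi => e1; [left | right]; exists x => //; split=> //.
    by move: E2; rewrite e1 => /set2P[|->//] e; move: xx; rewrite -e setU11.
  by move: E1; rewrite e1 => /set2P[|->//] e; move: xx; rewrite e setU11.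
have up_odd A B : up A B -> odd #|A| = q /\ #|B| = #|A|.+1.
  by case=> x xP [-> ->]; have [xx ->] := P_up xP; rewrite cardsU1 xx.
(* The start is shifted by one step, if needed, to lie on the lower level. *)
pose s := (odd #|f ord0| != q) : nat.
pose g k := f (inord ((k + s) %% 10)).
have gS k : g k.+1 = f (ordS (inord ((k + s) %% 10))).
  by congr f; apply/val_inj; rewrite /= !inordK ?ltn_pmod //; lia.
have g_up k : up (g k) (g k.+1) \/ up (g k.+1) (g k) by rewrite gS; apply: f_up.
have g_odd k : odd #|g k| = q (+) odd k.
  elim: k => [|k IHk].
    rewrite /g /s add0n.
    have f0 : f ord0 = f (inord 0) by congr f; apply/val_inj; rewrite /= inordK.
    case: eqP => [fq|/eqP fq] /=; first by rewrite addbF -f0.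
    have := f_up (inord 0); rewrite -f0.
    have -> : ordS (inord 0 : 'I_10) = inord (1 %% 10).
      by apply/val_inj; rewrite /= !inordK.
    by rewrite addbF => -[/up_odd[]|/up_odd[]] // fq'; rewrite fq' eqxx in fq.
  by case: (g_up k) => /up_odd[_ e]; move: IHk; rewrite e /=; case: (odd _); case: (odd k); case: q.
have g_up_even k : ~~ odd k -> up (g k) (g k.+1).
  move=> ok; case: (g_up k) => // /up_odd[]; rewrite g_odd /= ok.
  by case: q.
have g_up_odd k : odd k -> up (g k.+1) (g k).
  move=> ok; case: (g_up k) => // /up_odd[]; rewrite g_odd ok.
  by case: q.
have g_mod k : g k = g (k %% 10) by rewrite /g modnDml.
have g_inj j k : g j = g k -> j = k %[mod 10].
  move=> /f_inj /(congr1 val); rewrite /= !inordK ?ltn_pmod //; lia.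
have /fin_all_exists[e e_up] (j : 'I_10) : exists i : 'I_n,
    if odd j then (g j.+1, i) \in P /\ g j = i |: g j.+1
    else (g j, i) \in P /\ g j.+1 = i |: g j.
  case oj: (odd j).
    by have [[A i] ? /= [-> ->]] := g_up_odd _ oj; exists i.
  by have [[A i] ? /= [-> ->]] := g_up_even _ (negbT oj); exists i.
pose d k := e (inord (k %% 10)).
have d_mod k : d (k %% 10) = d k by rewrite /d modn_mod.
have d_up k : if odd k then (g k.+1, d k) \in P /\ g k = d k |: g k.+1
    else (g k, d k) \in P /\ g k.+1 = d k |: g k.
  have := e_up (inord (k %% 10)); rewrite inordK ?ltn_pmod // -g_mod -/(d k).
  have -> : g (k %% 10).+1 = g k.+1 by rewrite [LHS]g_mod [RHS]g_mod; congr g; lia.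
  by have -> : odd (k %% 10) = odd k by lia.
have mem_d k : (d k \in g k) = odd k.
  have := d_up k; case: (odd k) => -[/P_up[/= dk _] E]; last exact: negbTE.
  by rewrite E setU11.
have memS k x : (x \in g k.+1) = (x \in g k) (+) (x == d k).
  have := mem_d k; have := d_up k; case: (odd k) => -[/P_up[/= dk _] E].
    rewrite E !inE => _; case: (x =P d k) => [->|_]; last by rewrite addbF.
    by rewrite (negbTE dk).
  rewrite E !inE => dk'; case: (x =P d k) => [->|_]; last by rewrite addbF.
  by rewrite dk'.
have card_g k : #|g k| = #|g 0| + odd k.
  elim: k => [|k IHk]; first by rewrite addn0.
  have := d_up k; move: IHk; rewrite /=; case: (odd k) => IHk -[/P_up[/= dk _] E] /=.
    by move: IHk; rewrite E cardsU1 dk addn0 addn1 => -[].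
  by rewrite E cardsU1 dk IHk addn0 addn1.
have rank_d k : odd #|[set a in g k | a < d k]| = rank_odd (g 0) (d 0).
  have [/= P0 _] := d_up 0; have := d_up k; have := card_g k; have := card_g k.+1.
  rewrite /=; case: (odd k) => /= c1 c2 [Pk E].
    rewrite -(P_rank Pk P0) /= ?c1 ?addn0 // /rank_odd; congr (odd _); apply: eq_card => a.
    by rewrite !inE E !inE; case: eqP => // ->; rewrite ltnn !andbF.
  by rewrite -(P_rank Pk P0) //= c2 addn0.
have periodic k : g (k + 10) = g k by rewrite [LHS]g_mod modnDr -g_mod.
have g_neq j k : j < k -> k < 10 -> g j <> g k.
  by move=> ltjk ltk /g_inj; rewrite !modn_small //; lia.
have [k ok [d3 d4]] := ten_cycle_repeat mem_d memS periodic d_mod g_neq rank_d.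
have o1 : odd k.+1 by rewrite /= ok.
have ne : d k.+1 != d k.
  apply/eqP => dE; have : g k.+2 = g k.
    by apply/setP => x; rewrite !memS dE -addbA addbb addbF.
  by move/g_inj; lia.
pose S := g k :\ d k.+1.
have egk : d k.+1 \in g k by have := mem_d k.+1; rewrite o1 memS (negbTE ne) addbF.
have g0 : g k = d k.+1 |: S by rewrite setD1K.
(* The edges leaving [g k], [g k.+2] and [g (k + 4)] form a triangle over [S]. *)
have g2 : g k.+2 = d k |: S.
  apply/setP => x; rewrite !memS !inE.
  case: (x =P d k) => [->|_]; first by rewrite mem_d (negbTE ok) eq_sym (negbTE ne).
  by case: (x =P d k.+1) => [->|_]; rewrite ?egk // !addbF.
have P0 := d_up k; rewrite (negbTE ok) in P0.
have P2 := d_up k.+2; rewrite /= negbK (negbTE ok) in P2.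
have P4 := d_up (k + 4); rewrite -d4 oddD addbF (negbTE ok) in P4.
have g4 : g (k + 4) = d k.+2 |: S.
  have := mem_d k.+2; rewrite /= negbK (negbTE ok) g2 in_setU1 => /norP[/negPf d2k /negPf d2S].
  have := mem_d k; rewrite (negbTE ok) g0 in_setU1 => /norP[_ /negPf dkS].
  apply/setP => x; rewrite addn4 (memS k.+3) (memS k.+2) -[k.+3]addn3 -d3 g2 !in_setU1.
  case: (x =P d k) => [->|_]; first by rewrite dkS [d k == _]eq_sym d2k.
  by case: (x =P d k.+2) => [->|_]; rewrite ?d2S ?addbF.
apply: (P_triangle (S := S) (e := d k.+1) (d := d k) (c := d k.+2)).
by rewrite -g0 -g2 -g4; split; [case: P0 | case: P2 | case: P4].
Qed.
End CycleFree.

(** * The extremal number *)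

Lemma ex_hypercube_C10_ge n : n * 2 ^ n <= 64 * ex (hypercube n) (cycle_graph 10).
Proof.
have [P [q [P_up P_rank P_tri large]]] := ex_dense_family n.
apply: (leq_trans large); rewrite leq_mul2l /=.
pose edge (x : {set 'I_n} * 'I_n) : {set hypercube n} := [set x.1; x.2 |: x.1].
pose S : {set hypercube n} * {set {set hypercube n}} := (setT, edge @: P).
have edge_inj : {in P &, injective edge}.
  move=> [A i] [B j] AP BP; rewrite /edge /= => E.
  have [/= iA oA] := P_up _ AP; have [/= jB oB] := P_up _ BP.
  have AB : A = B.
    have : A \in [set B; j |: B] by rewrite -E set21.
    by case/set2P => // AE; move: oA; rewrite AE cardsU1 jB /= oB; case: (q).
  subst B; congr pair.
  have : i |: A \in [set A; j |: A] by rewrite -E set22.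
  case/set2P => AE; first by rewrite -AE setU11 in iA.
  by have := setU11 i A; rewrite AE !inE (negbTE iA) orbF => /eqP.
rewrite -(card_in_imset edge_inj); rewrite /ex.
apply: (@leq_bigmax_cond _ _ (fun S' : {set hypercube n} * {set {set hypercube n}} => #|S'.2|) S).
apply/andP; split.
  apply/andP; split; last by apply/forall_inP => e _; exact: subsetT.
  apply/subsetP => e /imsetP[[A i] /P_up[/= iA _] ->]; rewrite inE.
  apply/existsP; exists A; apply/existsP; exists (i |: A).
  by rewrite /= eqxx andbT /cube_adj /cube_cover subsetUr cardsU1 iA add1n eqxx.
apply/existsP => -[S' /andP[/and3P[_ _ /subsetP sub] /existsP[f /and3P[/injectiveP f_inj _ f_iso]]]].
apply: (no_ten_cycle P_up P_rank P_tri f_inj) => i.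
have /sub/imsetP[x xP E] : [set f i; f (ordS i)] \in S'.2.
  have /forallP/(_ (ordS i))/eqP <- := forallP f_iso i.
  rewrite /= /cycle_adj eqxx /= andbT; apply/eqP => /(congr1 val) /=.
  have := ltn_ord i; lia.
by exists x.
Qed.

Local Open Scope classical_set_scope.
Local Open Scope ring_scope.

Theorem theorem4 (R : realType) :
  (fun n : nat => (ex (hypercube n) (cycle_graph 10))%:R : R)
    \is 'Omega_\oo
      (fun n : nat => n%:R / (ln (n%:R : R)) `^ (ln 3 / ln 2) * 2 ^+ n : R).
Proof.
rewrite qualifE; apply/asboolP; exists (64%:R^-1); first by rewrite invr_gt0 ltr0n.
(* For n >= e the denominator is at least 1. *)
near=> n.
have ln_ge1 : 1 <= ln (n%:R : R).
  rewrite -[leLHS]expRK ler_ln ?posrE ?expR_gt0 //.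
    by near: n; exact: nbhs_infty_ger.
  by apply: (lt_le_trans (expR_gt0 1)); near: n; exact: nbhs_infty_ger.
have a_ge0 : 0 <= ln 3 / ln 2 :> R.
  by rewrite divr_ge0 // ln_ge0 // ler1n.
have pow_ge1 : 1 <= ln (n%:R : R) `^ (ln 3 / ln 2).
  have powR1E : 1 `^ (ln 3 / ln 2) = 1 :> R by rewrite powR1.
  rewrite -[leLHS]powR1E; apply: ge0_ler_powR; rewrite ?nnegrE //.
  exact: le_trans ln_ge1.
have n2_ge0 : 0 <= n%:R * 2 ^+ n :> R by rewrite mulr_ge0 ?exprn_ge0.
rewrite /= normr_nat ger0_norm; last first.
  by rewrite mulr_ge0 ?divr_ge0 ?exprn_ge0 // powR_ge0.
rewrite ler_pdivrMl ?ltr0n // -natrM.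
apply: (@le_trans _ _ ((n * 2 ^ n)%N%:R)); last by rewrite ler_nat ex_hypercube_C10_ge.
rewrite natrM natrX mulrAC ler_pdivrMr; last exact: lt_le_trans ltr01 pow_ge1.
by rewrite ler_peMr.
Unshelve. all: by end_near.
Qed.
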